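(* Let $d\ge 2$, $m=2^d$, let $r\ge 2$, $t=\lceil \log_2 r\rceil$, let $c\in\{0,\dots,r-1\}^m$ and $\ell\in\{0,\dots,r-1\}$. Let $\mathrm{Ind}\in\{0,1\}^m$ be given by $\mathrm{Ind}(i)=1$ if $c(i)=\ell$ and $\mathrm{Ind}(i)=0$ otherwise. For each prime $p\in \mathrm{Primes}_{m,d}$ let $b_p=\mathrm{SPiRiT}_p(\mathrm{Ind})\in\{0,\dots,p-1\}^d$, and let $i_p=1+\sum_{h=1}^d b_p(h)\,2^{h-1}$ (with the entries of $b_p$ read as integers in $\{0,\dots,p-1\}$). Let $C=\{i_p: p\in\mathrm{Primes}_{m,d}\}\cap[m]$, and let $i^\dagger=\min\{i\in C: c(i)=\ell\}$ (with $i^\dagger=0$ if this set is empty). Then $$i^\dagger=\min\{i\in[m]: c(i)=\ell\}$$ (where the minimum of the empty set is $0$). Moreover: $|\mathrm{Primes}_{m,d}|=O(\log^2 m/\log\log m)$; there is an absolute constant $K$ such that every $p\in\mathrm{Primes}_{m,d}$ satisfies $p\le K\log_2^2 m$; and, writing each entry of $c$ and $\ell$ by its $t$-bit binary representation, each coordinate of $b_p$ equals, as a function of these $(m+1)t$ bits (viewed as elements of $\mathbb Z_p$), a polynomial over $\mathbb Z_p$ of degree at most $2t(p-1)^2=O(\log^4 m\,\log r)$.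
   Context: Logarithms are base 2 unless stated. $[m]=\{1,\dots,m\}$. Let $m=2^d$. Consider the complete binary tree with nodes indexed $1,\dots,2m-1$: node $1$ is the root, node $k\in[m-1]$ has left child $2k$ and right child $2k+1$; nodes $m,\dots,2m-1$ are leaves, and leaf number $i\in[m]$ is node $m+i-1$. For $i\in[m]$ let $\mathrm{Anc}(i)=\{\lfloor (m+i-1)/2^h\rfloor: h=0,\dots,d\}$ (the ancestors of leaf $i$, including the leaf itself and the root), and $\mathrm{Lop}(i)=\{k-1: k\in \mathrm{Anc}(i),\ k\text{ odd},\ k\ge 3\}$ (the left siblings of those nodes of $\mathrm{Anc}(i)$ that are right children). Tree matrix $T\in\{0,1\}^{(2m-1)\times m}$: $T(k,i)=1$ iff $k\in\mathrm{Anc}(i)$. Roots matrix $R\in\{0,1\}^{m\times(2m-1)}$: for $j\in[m-1]$, $R(j,k)=1$ iff $k\in\mathrm{Lop}(j+1)$; row $m$ of $R$ is the indicator vector of $\{1\}$. Pairwise matrix $P\in\{-1,0,1\}^{m\times m}$: $(Pu)(1)=u(1)$ and $(Pu)(k)=u(k)-u(k-1)$ for $k\ge 2$. Sketch matrix $S\in\{0,1\}^{d\times m}$: $S(h,k)$ is the $h$-th bit (the coefficient of $2^{h-1}$) of $k-1$. For a prime $p$ and an integer vector $y$, $i_p(y)$ is the vector with entries $y(k)^{p-1}\bmod p$, and $\mathrm{SPiRiT}_p(x)=\big(SP\cdot i_p\big((R\cdot i_p(Tx\bmod p))\bmod p\big)\big)\bmod p$. For integers $m\ge 4$ and $s\ge1$,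 with $b=\lceil\log_2 m\rceil$, $\mathrm{Primes}_{m,s}$ is the set of the $N=1+\lfloor \lceil s\rceil\log_b m\rfloor$ smallest primes that are larger than $b$. *)

(* Defs.v *)
From Stdlib Require Import Reals.
From HB Require Import structures.
From mathcomp Require Import all_boot all_order all_algebra.
Set Implicit Arguments. Unset Strict Implicit. Unset Printing Implicit Defensive.
Import Order.TTheory GRing.Theory Num.Theory.

Local Open Scope ring_scope.

(* Throughout, m = 2^d; vectors are functions nat -> int indexed from 1. *)

Definition anc (d i : nat) : seq nat :=
  [seq ((2 ^ d + i - 1) %/ 2 ^ h)%N | h <- iota 0 d.+1].

Definition lop (d i : nat) : seq nat :=
  [seq k.-1 | k <- anc d i & odd k && (3 <= k)%N].

(* Tree matrix T (rows 1..2m-1, cols 1..m) *)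
Definition Tmat (d k i : nat) : int := ((k \in anc d i) : nat)%:Z.

(* Roots matrix R (rows 1..m, cols 1..2m-1) *)
Definition Rmat (d j k : nat) : int :=
  if (j < 2 ^ d)%N then ((k \in lop d j.+1) : nat)%:Z else ((k == 1%N) : nat)%:Z.

(* Sketch matrix S (rows 1..d, cols 1..m): S(h,k) = (h-th bit of k-1) *)
Definition Smat (h k : nat) : int := (odd ((k - 1) %/ 2 ^ (h - 1)) : nat)%:Z.

Definition Tapp (d : nat) (x : nat -> int) (k : nat) : int :=
  \sum_(1 <= i < (2 ^ d).+1) Tmat d k i * x i.
Definition Rapp (d : nat) (y : nat -> int) (j : nat) : int :=
  \sum_(1 <= k < 2 * 2 ^ d) Rmat d j k * y k.
Definition Papp (u : nat -> int) (k : nat) : int :=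
  if k == 1%N then u 1%N else u k - u k.-1.
Definition Sapp (d : nat) (u : nat -> int) (h : nat) : int :=
  \sum_(1 <= k < (2 ^ d).+1) Smat h k * u k.

Definition modv (p : nat) (y : nat -> int) (k : nat) : int := (y k %% p%:Z)%Z.
Definition ipow (p : nat) (y : nat -> int) (k : nat) : int :=
  ((y k ^+ p.-1) %% p%:Z)%Z.

Definition spirit (d p : nat) (x : nat -> int) (h : nat) : nat :=
  `| modv p (Sapp d (Papp (ipow p (modv p (Rapp d (ipow p (modv p (Tapp d x)))))))) h |%N.

Definition next_prime (x : nat) : nat :=
  ex_minn (let: exist2 p Hp1 Hp2 := prime_above x in
           ex_intro (fun q => (x < q)%N && prime q) p (introT andP (conj Hp1 Hp2))).

Fixpoint primes_above (x N : nat) : seq nat :=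
  if N is N'.+1 then next_prime x :: primes_above (next_prime x) N' else [::].

(* Primes_{m,s} for natural s (so ceil s = s):
   b = ceil(log2 m) = up_log 2 m,
   N = 1 + floor(s * log_b m) = 1 + trunc_log b (m ^ s)
   (floor(s log_b m) is the largest n with b^n <= m^s). *)
Definition Primes (m s : nat) : seq nat :=
  let b := up_log 2 m in primes_above b (trunc_log b (m ^ s)).+1.

Definition min0 (s : seq nat) : nat :=
  if s is x :: s' then foldl minn x s' else 0%N.

Definition Ind (c : nat -> nat) (l : nat) (i : nat) : int := ((c i == l) : nat)%:Z.

Definition idx (d p : nat) (x : nat -> int) : nat :=
  (1 + \sum_(1 <= h < d.+1) spirit d p x h * 2 ^ (h - 1))%N.

Definition Cset (d : nat) (c : nat -> nat) (l : nat) : seq nat :=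
  [seq i <- [seq idx d p (Ind c l) | p <- Primes (2 ^ d) d] | (1 <= i <= 2 ^ d)%N].

Definition idagger (d : nat) (c : nat -> nat) (l : nat) : nat :=
  min0 [seq i <- Cset d c l | c i == l].

(* Multivariate polynomials of total degree <= D in variables indexed by a
   finite type V over a commutative ring F: coefficient a(e) for every
   exponent vector e (entries <= D), only monomials of total degree <= D count. *)
Definition mpoly (F : comNzRingType) (V : finType) (D : nat) :=
  {ffun {ffun V -> 'I_D.+1} -> F}.
Definition mpoly_eval (F : comNzRingType) (V : finType) (D : nat)
    (a : mpoly F V D) (x : V -> F) : F :=
  \sum_(e : {ffun V -> 'I_D.+1} | (\sum_(v : V) (e v : nat) <= D)%N)
     a e * \prod_(v : V) x v ^+ e v.

Definition bit (n j : nat) : nat := odd (n %/ 2 ^ j).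

Definition input_bits (F : comNzRingType) (d t : nat) (c : nat -> nat) (l : nat)
    (v : 'I_((2 ^ d).+1) * 'I_t) : F :=
  let: (i, j) := v in
  (if (i < 2 ^ d)%N then bit (c i.+1) j else bit l j)%:R.

Definition log2R (x : R) : R := Rdiv (ln x) (ln (INR 2)).

(* Main.v *)
Require Import Defs.
From Stdlib Require Import Reals Lra.
From HB Require Import structures.
From mathcomp Require Import all_boot all_order all_algebra.
From mathcomp Require Import zify.

(** Let [i] be the first match and call a prime good if it divides none of the
    match counts at the ancestors of leaf [i].  Modulo a good prime [p > d],
    the sum over the roots covering [1..j] vanishes for [j < i], since all
    their counts are 0, and for [j >= i] it lies in [1, d], since one of these
    roots is an ancestor of [i].  Fermat turns these sums into the step
    function at [i], whose discrete derivative is the unit vector at [i], and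
    the sketch reads off the bits of [i - 1].  Bad primes only produce
    candidates that are filtered out or larger.  A good prime exists because
    the counts at the ancestors multiply to at most [(2^d)^d], which is less
    than the product of the primes.

    The size of the primes is Chebyshev's lower bound
    [2^n <= C(2n, n) <= (2n)^pi(2n)] with [2n = 64 d^2].  The degree comes from
    writing equality of two bits as [1 - (x - y)^2] and applying the power
    [p - 1] twice. *)

Set Implicit Arguments.
Unset Strict Implicit.
Unset Printing Implicit Defensive.

Import GRing.Theory.

(** * Chebyshev's bound and the primes of [Primes] *)

Lemma size_primes_above (x N : nat) : size (primes_above x N) = N.
Proof. by elim: N x => //= N IH x; rewrite IH. Qed.

Lemma next_primeP (x : nat) :
  [/\ x < next_prime x, prime (next_prime x)
    & forall q, x < q -> prime q -> next_prime x <= q].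
Proof.
rewrite /next_prime; case: ex_minnP => p /andP[xp pp] minp.
by split=> // q xq pq; apply: minp; rewrite xq.
Qed.

Lemma mem_primes_above (x N p : nat) :
  p \in primes_above x N -> (x < p) && prime p.
Proof.
elim: N x => //= N IH x; have [lt_x pr_x _] := next_primeP x.
rewrite inE => /orP[/eqP-> | /IH/andP[lt_p ->]]; first by rewrite lt_x.
by rewrite (ltn_trans lt_x lt_p).
Qed.

Lemma uniq_primes_above (x N : nat) : uniq (primes_above x N).
Proof.
elim: N x => //= N IH x; rewrite IH andbT.
by apply/negP => /mem_primes_above; rewrite ltnn.
Qed.

(** Each step uses up exactly one prime of the interval: none lies strictly between [x] and
    [next_prime x], so cutting there lowers the count by one. *)
Lemma primes_above_leq (x N X p : nat) :
  N <= count prime (index_iota x.+1 X.+1) -> p \in primes_above x N -> p <= X.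
Proof.
elim: N x => //= N IH x leN.
have [lt_x pr_x min_x] := next_primeP x.
have le_nX: next_prime x <= X.
  have /hasP[q] : has prime (index_iota x.+1 X.+1).
    by rewrite has_count; apply: leq_trans leN.
  rewrite mem_index_iota ltnS => /andP[xq qX] pq.
  exact: leq_trans (min_x q xq pq) qX.
rewrite inE => /orP[/eqP-> // | ]; apply: IH.
move: leN; rewrite {1}/index_iota.
have -> : X.+1 - x.+1 = (next_prime x - x.+1) + (X.+1 - (next_prime x).+1).+1 by lia.
rewrite iotaD count_cat [count _ (iota x.+1 _)](_ : _ = 0); last first.
  apply/eqP; rewrite -leqn0 leqNgt -has_count; apply/hasPn => q.
  rewrite mem_iota => /andP[xq q_lt]; apply/negP => /(min_x q xq).
  lia.
rewrite (_ : x.+1 + _ = next_prime x); last by lia.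
by rewrite add0n /= pr_x add1n ltnS.
Qed.

(** * Prime powers in the central binomial coefficient *)

Lemma sum_nat_of_bool (T : Type) (r : seq T) (P : pred T) :
  \sum_(k <- r) (P k : nat) = count P r.
Proof. by elim: r => [|k r IH]; rewrite ?big_nil // big_cons IH. Qed.

(** By Pascal's rule the next central coefficient is the sum of two binomials, each at least the
    current one. *)
Lemma exp2_leq_central_bin (n : nat) : 2 ^ n <= 'C(n.*2, n).
Proof.
elim: n => // n IH; rewrite doubleS binS expnS mul2n -addnn.
apply: leq_trans (leq_add IH IH) (leq_add _ _); last exact: leq_bin2l.
by rewrite binS leq_addl.
Qed.

(** By Legendre's formula the exponent is the sum over [k] of [n.*2 %/ p ^ k] minus twice
    [n %/ p ^ k]. Each term is 0 or 1, and it vanishes once [p ^ k] exceeds [n.*2]. *)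
Lemma logn_central_bin (n p : nat) : 0 < n -> prime p ->
  logn p 'C(n.*2, n) <= trunc_log p n.*2.
Proof.
move=> n_gt0 pr_p; have p_gt1 := prime_gt1 pr_p.
have le_n : n <= n.*2 by lia.
have := bin_fact le_n; rewrite (_ : n.*2 - n = n); last by lia.
move/(congr1 (logn p)); rewrite !lognM ?muln_gt0 ?fact_gt0 ?bin_gt0 //.
rewrite !logn_fact // (big_cat_nat (n := n.+1) (p := n.*2.+1)) //=.
(* Legendre's sum for [n] is padded with zero terms up to [n.*2], so that both sums can be compared
   term by term. *)
have tail0 : \sum_(n.+1 <= k < n.*2.+1) n %/ p ^ k = 0.
  rewrite big_nat big1 // => k /andP[n_lt _].
  by rewrite divn_small // (ltn_trans n_lt) // ltn_expl.
have full : \sum_(1 <= k < n.+1) n %/ p ^ k = \sum_(1 <= k < n.*2.+1) n %/ p ^ k.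
  by rewrite [RHS](big_cat_nat (n := n.+1)) //= tail0 addn0.
rewrite -big_cat_nat //= full => eq_log.
have divp k : n.*2 %/ p ^ k <= n %/ p ^ k + n %/ p ^ k + (k <= trunc_log p n.*2).
  have [k_le | k_gt] := leqP k (trunc_log p n.*2).
    have q_gt0 : 0 < p ^ k by rewrite expn_gt0 prime_gt0.
    by rewrite -addnn divnD // leq_add2l leq_b1.
  rewrite divn_small //; apply: leq_trans (trunc_log_ltn _ p_gt1) _.
  by rewrite leq_exp2l.
have le_sum : \sum_(1 <= k < n.*2.+1) (k <= trunc_log p n.*2) <= trunc_log p n.*2.
  rewrite sum_nat_of_bool -size_filter -[X in _ <= X](size_iota 1).
  apply: uniq_leq_size => [|k]; first by rewrite filter_uniq // iota_uniq.
  by rewrite mem_filter mem_index_iota mem_iota; lia.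
have := @leq_sum _ (index_iota 1 n.*2.+1) xpredT _ _ (fun k _ => divp k).
rewrite !big_split /= -eq_log; lia.
Qed.

(** Each prime power in the factorization is at most [n.*2]; hence so is each prime divisor, which
    bounds the number of factors as well. *)
Lemma central_bin_leq (n : nat) : 0 < n ->
  'C(n.*2, n) <= n.*2 ^ count prime (index_iota 1 n.*2.+1).
Proof.
move=> n_gt0; set C := 'C(_, _).
have C_gt0 : 0 < C by rewrite bin_gt0; lia.
have pw p : prime p -> p ^ logn p C <= n.*2.
  move=> pr_p; apply: leq_trans (trunc_logP (prime_gt1 pr_p) _); last by lia.
  by rewrite leq_exp2l ?prime_gt1 // logn_central_bin.
rewrite [X in X <= _](prod_prime_decomp C_gt0) prime_decompE big_map /=.
apply: leq_trans (_ : \prod_(p <- primes C) n.*2 <= _).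
  rewrite big_seq [X in _ <= X]big_seq; apply: leq_prod => p.
  by rewrite mem_primes => /and3P[pr_p _ _]; apply: pw.
rewrite big_const_seq count_predT iter_muln_1 leq_pexp2l //; first by lia.
rewrite -size_filter; apply: uniq_leq_size (primes_uniq _) _ => p.
rewrite mem_primes mem_filter mem_index_iota => /and3P[pr_p _ p_dvd].
rewrite pr_p prime_gt0 //= ltnS; apply: leq_trans (pw p pr_p).
rewrite -{1}[p]expn1 leq_exp2l ?prime_gt1 //.
by rewrite -pfactor_dvdn.
Qed.

(** Otherwise at most [t] primes lie in the interval and at most [d] below it, so
    [2 ^ (32 * d ^ 2) <= X ^ (d + t)]. But [X <= d ^ 8], and [d ^ d] and [d ^ t] are at most
    [2 ^ (d * d)], so the right side is at most [2 ^ (16 * d ^ 2)]. *)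
Lemma chebyshev_primes (d X : nat) : 2 <= d -> X = 64 * d ^ 2 ->
  (trunc_log d ((2 ^ d) ^ d)).+1 <= count prime (index_iota d.+1 X.+1).
Proof.
move=> d_ge2 defX; set t := trunc_log _ _.
have d_gt0 : 0 < d by lia.
have t_le : d ^ t <= 2 ^ (d * d) by rewrite expnM trunc_logP // !expn_gt0.
have X2 : X = (32 * d ^ 2).*2 by lia.
have n_gt0 : 0 < 32 * d ^ 2 by rewrite muln_gt0 expn_gt0 d_gt0.
rewrite ltnNge; apply/negP => few.
have := leq_trans (exp2_leq_central_bin _) (central_bin_leq n_gt0).
rewrite -X2 /index_iota subn1 /=.
have -> : X = d + (X.+1 - d.+1) by nia.
rewrite iotaD count_cat add1n.
move: few; rewrite /index_iota; set q := count _ (iota d.+1 _) => few.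
have X_le : d + (X.+1 - d.+1) <= d ^ 8.
  have : 2 ^ 6 <= d ^ 6 by rewrite leq_exp2r.
  have -> : d + (X.+1 - d.+1) = X by nia.
  by rewrite defX (expnD d 6 2) leq_mul2r => ->; rewrite orbT.
have count_le : count prime (iota 1 d) + q <= d + t.
  by rewrite leq_add //; apply: leq_trans (count_size _ _) _; rewrite size_iota.
rewrite leqNgt => /negP[].
apply: leq_ltn_trans (_ : (d ^ 8) ^ (d + t) < _).
  apply: leq_trans (leq_pexp2l _ count_le); last by rewrite expn_gt0 d_gt0.
  by case: (_ + q) => // k; rewrite leq_exp2r.
rewrite -expnM mulnC expnM expnD.
apply: leq_ltn_trans (_ : (2 ^ (d * d) * 2 ^ (d * d)) ^ 8 < _).
  rewrite leq_exp2r // leq_mul // expnM leq_exp2r //.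
  by rewrite ltnW // ltn_expl.
by rewrite -expnD -expnM ltn_exp2l //; nia.
Qed.

Lemma Primes_exp2E (d : nat) :
  Primes (2 ^ d) d = primes_above d (trunc_log d ((2 ^ d) ^ d)).+1.
Proof. by rewrite /Primes up_expnK. Qed.

Lemma Primes_exp2_leq (d p : nat) :
  2 <= d -> p \in Primes (2 ^ d) d -> p <= 64 * d ^ 2.
Proof.
move=> d_ge2; rewrite Primes_exp2E; apply: primes_above_leq.
exact: chebyshev_primes.
Qed.

(** * Recovery of the first match *)

Definition leaf_count (d : nat) (c : nat -> nat) (l k : nat) : nat :=
  count (fun i => (k \in anc d i) && (c i == l)) (index_iota 1 (2 ^ d).+1).

Lemma min0_eq (s : seq nat) (x : nat) :
  x \in s -> (forall y, y \in s -> x <= y) -> min0 s = x.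
Proof.
have foldl_min a t : (forall y, y \in a :: t -> foldl minn a t <= y) /\
    foldl minn a t \in a :: t.
  elim: t a => [|b t IH] a /=; first by split=> [y|]; rewrite inE // => /eqP->.
  have [lb mem] := IH (minn a b); split=> [y|].
    have lb0 := lb _ (mem_head _ _).
    rewrite !inE => /or3P[/eqP->|/eqP->|yt]; [lia | lia | ].
    by apply: lb; rewrite inE yt orbT.
  move: mem; rewrite !inE => /orP[/eqP-> | ->]; last by rewrite !orbT.
  by rewrite /minn; case: ifP; rewrite eqxx ?orbT.
case: s => // a t x_in x_min; have [lb mem] := foldl_min a t.
by apply/eqP; rewrite eqn_leq lb //= x_min.
Qed.

Lemma sum_bits (d n : nat) : n < 2 ^ d ->
  \sum_(1 <= h < d.+1) odd (n %/ 2 ^ (h - 1)) * 2 ^ (h - 1) = n.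
Proof.
move=> n_lt; rewrite big_add1 /=.
under eq_bigr do rewrite subn1 /=.
elim: d n n_lt => [|d IH] n; first by rewrite ltnS leqn0 => /eqP->; rewrite big_nil.
rewrite expnS => n_lt; rewrite big_nat_recl // divn1 muln1.
under eq_bigr => i _ do rewrite expnS divnMA divn2 mulnCA.
rewrite -big_distrr /= IH; last by lia.
by rewrite mul2n odd_double_half.
Qed.

(** * Ancestors and left siblings in the tree *)

Lemma ancP (d i k : nat) :
  reflect (exists2 h, h <= d & k = (2 ^ d + i - 1) %/ 2 ^ h) (k \in anc d i).
Proof.
apply: (iffP mapP) => [[h] | [h le_h ->]].
  by rewrite mem_iota => /andP[_ lt_h] ->; exists h.
by exists h => //; rewrite mem_iota.
Qed.

Lemma anc_bounds (d i k : nat) : 1 <= i <= 2 ^ d -> k \in anc d i ->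
  1 <= k < 2 * 2 ^ d.
Proof.
move=> i_in /ancP[h le_h ->]; have q_gt0 : 0 < 2 ^ h by rewrite expn_gt0.
have : 2 ^ h <= 2 ^ d by rewrite leq_exp2l.
move=> le_q; rewrite divn_gt0 //; apply/andP; split; first by lia.
by apply: leq_ltn_trans (leq_div _ _) _; lia.
Qed.

Lemma root_anc (d i : nat) : 1 <= i <= 2 ^ d -> (2 ^ d + i - 1) %/ 2 ^ d = 1.
Proof.
move=> i_in; rewrite -addnBA; last by lia.
rewrite divnDl // divnn expn_gt0 /= divn_small //; lia.
Qed.

Lemma lopP (d i k : nat) :
  reflect (exists2 h, h <= d & [/\ odd ((2 ^ d + i - 1) %/ 2 ^ h),
      3 <= (2 ^ d + i - 1) %/ 2 ^ h & k.+1 = (2 ^ d + i - 1) %/ 2 ^ h])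
    (k \in lop d i).
Proof.
apply: (iffP mapP) => [[k']|[h le_h [odd_k k_ge3 eq_k]]].
  rewrite mem_filter => /andP[/andP[odd_k k_ge3] /ancP[h le_h def_k]] ->.
  by exists h => //; rewrite -def_k; split=> //; lia.
exists k.+1 => //; rewrite mem_filter eq_k odd_k k_ge3 /=.
by apply/ancP; exists h.
Qed.

(** A left sibling on the path to leaf [j.+1] covers only leaves to the left of it. Suppose [j < i],
    with [k.+1] at height [h] and [k] at height [h']. If [h' <= h], monotonicity of division gives
    [k.+1 <= k]; otherwise the levels of the two nodes conflict. *)
Lemma lop_anc_leq (d i j k : nat) : 1 <= i <= 2 ^ d -> j < 2 ^ d ->
  k \in lop d j.+1 -> k \in anc d i -> i <= j.
Proof.
move=> i_in j_lt /lopP[h le_h [odd_k k_ge3 eq_k]] /ancP[h' le_h' def_k].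
rewrite leqNgt; apply/negP => lt_ji.
move: odd_k k_ge3 eq_k; rewrite addnS subn1 /= => odd_k k_ge3 eq_k.
have le_AB : 2 ^ d + j <= 2 ^ d + i - 1 by lia.
have [le_hh | lt_hh] := leqP h' h.
  have : (2 ^ d + j) %/ 2 ^ h <= k; last by lia.
  rewrite def_k; apply: leq_trans (leq_div2r _ le_AB) _.
  by apply: leq_div2l; rewrite ?expn_gt0 // leq_exp2l.
(* The level at height [h] starts at the even index [2 ^ (d - h)]. The odd node [k.+1] is not its
   first, so [k] is in that level too, whereas a node at height [h' > h] has a smaller index. *)
have lt_hd : h < d by lia.
have le_pow : 2 ^ (d - h) <= (2 ^ d + j) %/ 2 ^ h.
  by rewrite leq_divRL ?expn_gt0 // -expnD subnK ?leq_addr // ltnW.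
have neq_pow : 2 ^ (d - h) != (2 ^ d + j) %/ 2 ^ h.
  by apply: contraTneq odd_k => <-; rewrite oddX /= orbF subn_eq0 -ltnNge.
have : k < 2 ^ (d - h); last by lia.
rewrite def_k ltn_divLR ?expn_gt0 // -expnD.
have : 2 ^ d.+1 <= 2 ^ (d - h + h') by rewrite leq_exp2l //; lia.
rewrite expnS; lia.
Qed.

(** Just below the lowest common ancestor of leaves [i] and [j.+1], the path to [i] goes left and
    the path to [j.+1] goes right; the left child is the witness. *)
Lemma lop_anc_ex (d i j : nat) : 1 <= i <= j -> j < 2 ^ d ->
  exists2 k, k \in lop d j.+1 & k \in anc d i.
Proof.
move=> i_in j_lt.
pose same h := (2 ^ d + j) %/ 2 ^ h == (2 ^ d + i - 1) %/ 2 ^ h.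
have same_d : same d.
  rewrite /same root_anc; last by lia.
  by have := @root_anc d j.+1; rewrite addnS subn1 /= => ->.
have ex_same : exists h, same h by exists d.
case: (ex_minnP ex_same) => -[|h] same_h min_h.
  move: same_h; rewrite /same !divn1; lia.
have lt_hd : h < d by apply: min_h.
have : ~~ same h by apply/negP => /min_h; rewrite ltnn.
move: same_h; rewrite /same !expnSr !divnMA !divn2.
set A := (2 ^ d + j) %/ 2 ^ h; set B := (2 ^ d + i - 1) %/ 2 ^ h => eq_half neq.
have le_BA : B <= A by apply: leq_div2r; lia.
have A_ge2 : 2 <= A.
  rewrite leq_divRL ?expn_gt0 // -expnS; apply: leq_trans (leq_addr _ _).
  by rewrite leq_exp2l.
have B_eq : B.+1 = A /\ odd A by lia.
exists B.
  apply/lopP; exists h; first exact: ltnW.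
  by rewrite addnS subn1 /= -/A; split; lia.
by apply/ancP; exists h => //; exact: ltnW.
Qed.

(** Of the [d.+1] ancestors, the root has no left sibling. This bound keeps the sums over roots
    below any prime [p > d]. *)
Lemma size_lop (d i : nat) : 1 <= i <= 2 ^ d -> size (lop d i) <= d.
Proof.
move=> i_in; rewrite size_map size_filter /anc -[d.+1]addn1 iotaD map_cat count_cat /=.
rewrite root_anc //= !addn0; apply: leq_trans (count_size _ _) _.
by rewrite size_map size_iota.
Qed.

(** * Divisibility by primes, and the matrices as counts *)

Lemma prod_primes_dvd (s : seq nat) (Z : nat) : uniq s ->
  {in s, forall p, prime p && (p %| Z)} -> \prod_(p <- s) p %| Z.
Proof.
elim: s => [|p s IH] /=; first by rewrite big_nil dvd1n.
move=> /andP[p_notin uniq_s] s_dvd; have /andP[pr_p p_dvd] := s_dvd _ (mem_head _ _).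
have s_dvd' : {in s, forall q, prime q && (q %| Z)}.
  by move=> q qs; apply: s_dvd; rewrite inE qs orbT.
rewrite big_cons Gauss_dvd ?p_dvd ?IH //.
elim: s {IH uniq_s s_dvd} p_notin s_dvd' => [|q s IH]; first by rewrite big_nil coprimen1.
rewrite inE negb_or => /andP[neq_pq p_notin] s_dvd.
have /andP[pr_q _] := s_dvd _ (mem_head _ _).
rewrite big_cons coprimeMr prime_coprime // dvdn_prime2 // neq_pq IH //.
by move=> r rs; apply: s_dvd; rewrite inE rs orbT.
Qed.

Lemma expn_pred_prime_mod (p n : nat) : prime p -> n ^ p.-1 %% p = ~~ (p %| n).
Proof.
move=> pr_p; have p_gt1 := prime_gt1 pr_p; have [p_dvd | p_ndvd] := boolP (p %| n).
  apply/eqP; apply: dvdn_trans p_dvd _; apply: dvdn_exp => //; lia.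
have n_gt0 : 0 < n by case: n p_ndvd => //; rewrite dvdn0.
(* Fermat in the form [n ^ p = n] modulo [p]; the factor [n], coprime to [p], is then cancelled. *)
have /eqP := fermat_little n pr_p; rewrite -{1}(prednK (prime_gt0 pr_p)) expnS.
rewrite -{3}[n]muln1 eqn_mod_dvd; last by rewrite leq_pmul2l // expn_gt0 n_gt0.
rewrite -mulnBr Gauss_dvdr ?prime_coprime // -eqn_mod_dvd ?expn_gt0 ?n_gt0 //.
by move/eqP->; rewrite modn_small.
Qed.

Lemma ipow_modv_nat (p n k : nat) (y : nat -> int) : prime p -> y k = Posz n ->
  ipow p (modv p y) k = Posz (~~ (p %| n)).
Proof.
move=> pr_p yE; rewrite /ipow /modv yE modz_nat.
have PoszX a e : (Posz a ^+ e)%R = Posz (a ^ e).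
  by elim: e => // e IH; rewrite exprS IH expnS PoszM.
by rewrite PoszX modz_nat modnXm expn_pred_prime_mod.
Qed.

Lemma Posz_count (T : Type) (r : seq T) (P : pred T) :
  (\sum_(k <- r) Posz (P k))%R = Posz (count P r).
Proof. by elim: r => [|k r IH]; rewrite ?big_nil // big_cons IH -PoszD. Qed.

Lemma Tapp_Ind (d : nat) (c : nat -> nat) (l k : nat) :
  Tapp d (Ind c l) k = Posz (leaf_count d c l k).
Proof.
rewrite /Tapp /leaf_count -Posz_count; apply: eq_bigr => i _.
by rewrite /Tmat /Ind -PoszM mulnb.
Qed.

Definition root_count (d : nat) (v : pred nat) (j : nat) : nat :=
  if j < 2 ^ d then count (fun k => (k \in lop d j.+1) && v k) (index_iota 1 (2 * 2 ^ d))
  else v 1.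

Lemma Rapp_indicator (d : nat) (v : pred nat) (y : nat -> int) (j : nat) :
  (forall k, y k = Posz (v k)) -> Rapp d y j = Posz (root_count d v j).
Proof.
move=> yE; rewrite /Rapp /Rmat /root_count; case: ifP => _.
  by rewrite -Posz_count; apply: eq_bigr => k _; rewrite yE -PoszM mulnb.
have m_gt0 : 0 < 2 ^ d by rewrite expn_gt0.
rewrite big_ltn; last by lia.
rewrite yE mul1r big_nat big1 ?addr0 // => k /andP[k_gt1 _].
by rewrite (gtn_eqF k_gt1) mul0r.
Qed.

(** * Decoding modulo a good prime *)

Section FirstMatch.

Variables (d p : nat) (c : nat -> nat) (l i : nat).
Hypotheses (pr_p : prime p) (lt_dp : d < p) (i_in : 1 <= i <= 2 ^ d).
Hypotheses (ci : c i = l) (i_min : forall j, 1 <= j < i -> c j != l).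
Hypothesis good_p : forall k, k \in anc d i -> ~~ (p %| leaf_count d c l k).

Let v k := ~~ (p %| leaf_count d c l k).

Lemma root_count_lt_prime (j : nat) : root_count d v j < p.
Proof.
rewrite /root_count; case: ifP => j_lt; last first.
  by apply: leq_ltn_trans (leq_b1 _) (prime_gt1 pr_p).
apply: leq_ltn_trans lt_dp; apply: leq_trans (size_lop (i := j.+1) _) => //.
rewrite -size_filter; apply: uniq_leq_size; first by rewrite filter_uniq // iota_uniq.
by move=> k; rewrite mem_filter => /andP[/andP[]].
Qed.

Lemma root_count_before (j : nat) : j < i -> root_count d v j = 0.
Proof.
move=> j_lt; rewrite /root_count; case: ifP => [j_ltm|]; last by lia.
apply/eqP; rewrite -leqn0 leqNgt -has_count; apply/hasPn => k _.
apply/negP => /andP[k_lop]; apply/negP; rewrite negbK.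
rewrite [leaf_count _ _ _ _](_ : _ = 0) ?dvdn0 //.
apply/eqP; rewrite -leqn0 leqNgt -has_count; apply/hasPn => i'.
rewrite mem_index_iota ltnS => i'_in; apply/negP => /andP[k_anc].
apply/negP/i_min; have := lop_anc_leq i'_in j_ltm k_lop k_anc; lia.
Qed.

Lemma root_count_after (j : nat) : i <= j -> 0 < root_count d v j.
Proof.
move=> le_ij; rewrite /root_count; case: ifP => j_lt; last first.
  rewrite lt0b; apply: good_p; apply/ancP; exists d => //.
  by rewrite root_anc.
have /andP[i_gt0 _] := i_in.
have [|k k_lop k_anc] := lop_anc_ex (i := i) _ j_lt; first by rewrite i_gt0.
rewrite -has_count; apply/hasP; exists k; last by rewrite k_lop; exact: good_p.
by rewrite mem_index_iota; exact: anc_bounds k_anc.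
Qed.

Lemma idx_first_match : idx d p (Ind c l) = i.
Proof.
pose u := ipow p (modv p (Rapp d (ipow p (modv p (Tapp d (Ind c l)))))).
have uE j : u j = Posz (i <= j).
  have vE k : ipow p (modv p (Tapp d (Ind c l))) k = Posz (v k).
    by apply: ipow_modv_nat => //; exact: Tapp_Ind.
  rewrite /u (ipow_modv_nat pr_p (Rapp_indicator _ _ vE)).
  have [le_ij | lt_ji] := leqP i j; last by rewrite root_count_before // dvdn0.
  by rewrite gtnNdvd ?root_count_after ?root_count_lt_prime.
(* The backward difference of the step at [i]. The first entry has no predecessor, but [1 <= i]
   makes [u 1] equal to 1 exactly when [i] is 1. *)
have PuE k : 1 <= k -> Papp u k = Posz (k == i).
  move=> k_gt0; rewrite /Papp !uE; case: eqP => [-> | _]; first by congr Posz; lia.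
  by lia.
(* Only column [i] of the sketch survives, and its bits are already reduced modulo [p]. *)
have bitE h : spirit d p (Ind c l) h = odd ((i - 1) %/ 2 ^ (h - 1)).
  rewrite /spirit -/u /modv /Sapp (bigD1_seq i) ?iota_uniq ?mem_index_iota //=.
  rewrite big_seq_cond big1 ?addr0 => [|k /andP[]]; last first.
    by rewrite mem_index_iota => /andP[k_gt0 _] /negPf nki; rewrite PuE // nki mulr0.
  rewrite PuE ?eqxx ?mulr1; last by case/andP: i_in.
  by rewrite /Smat modz_nat modn_small // (leq_ltn_trans (leq_b1 _)) ?prime_gt1.
rewrite /idx; under eq_bigr do rewrite bitE.
rewrite sum_bits; lia.
Qed.

End FirstMatch.

(** * Existence of a good prime and correctness *)

Lemma leaf_count_leaf (d : nat) (c : nat -> nat) (l i : nat) :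
  1 <= i <= 2 ^ d -> leaf_count d c l (2 ^ d + i - 1) <= 1.
Proof.
move=> i_in; rewrite /leaf_count -size_filter -[X in _ <= X]/(size [:: i]).
apply: uniq_leq_size; first by rewrite filter_uniq // iota_uniq.
move=> j; rewrite mem_filter mem_index_iota => /andP[/andP[/ancP[h _ eq_h] _] j_in].
rewrite inE; apply/eqP.
case: h eq_h => [|h] eq_h.
  by rewrite divn1 in eq_h; lia.
(* A proper ancestor of a leaf has index below [2 ^ d], so it is not a leaf. *)
have : (2 ^ d + j - 1) %/ 2 ^ h.+1 <= (2 ^ d + j - 1) %/ 2.
  by apply: leq_div2l => //; rewrite expnS leq_pmulr // expn_gt0.
lia.
Qed.

(* The leaf itself has count 1, so only the d proper ancestors can be divisible
   by a prime; their counts multiply to at most (2^d)^d, less than the product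
   of the primes. *)
Lemma good_prime_ex (d : nat) (c : nat -> nat) (l i : nat) :
  2 <= d -> 1 <= i <= 2 ^ d -> c i = l ->
  exists2 p, p \in Primes (2 ^ d) d &
    forall k, k \in anc d i -> ~~ (p %| leaf_count d c l k).
Proof.
move=> d_ge2 i_in ci; rewrite Primes_exp2E; set N := _.+1.
pose good p := all (fun k => ~~ (p %| leaf_count d c l k)) (anc d i).
case: (boolP (has good (primes_above d N))) => [/hasP[p p_in /allP]|].
  by exists p.
move/hasPn => bad; exfalso.
have mem_le k : leaf_count d c l k <= 2 ^ d.
  by apply: leq_trans (count_size _ _) _; rewrite size_iota subn1.
have mem_gt0 k : k \in anc d i -> 0 < leaf_count d c l k.
  move=> k_anc; rewrite -has_count; apply/hasP; exists i.
    by rewrite mem_index_iota ltnS.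
  by rewrite k_anc ci eqxx.
pose Z := \prod_(k <- anc d i) leaf_count d c l k.
have Z_gt0 : 0 < Z by rewrite /Z big_seq prodn_cond_gt0.
have Z_le : Z <= (2 ^ d) ^ d.
  rewrite /Z /anc big_map big_cons divn1 -[X in _ <= X]mul1n leq_mul //.
    exact: leaf_count_leaf.
  apply: leq_trans (leq_prod (fun h _ => mem_le _)) _.
  by rewrite big_const_seq count_predT size_iota iter_muln_1.
have Z_dvd : \prod_(p <- primes_above d N) p %| Z.
  apply: prod_primes_dvd (uniq_primes_above _ _) _ => p p_in.
  have /andP[_ ->] := mem_primes_above p_in.
  have /allPn[k k_anc] := bad p p_in; rewrite negbK => /dvdn_trans-> //.
  by rewrite /Z (big_rem k) //= dvdn_mulr.
(* All [N] primes exceed [d], so their product is at least [d ^ N], which by the choice of [N]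
   exceeds [(2 ^ d) ^ d]. *)
have := trunc_log_ltn ((2 ^ d) ^ d) d_ge2; rewrite ltnNge => /negP[].
apply: leq_trans Z_le; apply: leq_trans (dvdn_leq Z_gt0 Z_dvd).
rewrite -/N -{1}(size_primes_above d N) -iter_muln_1 -count_predT.
rewrite -big_const_seq big_seq [X in _ <= X]big_seq; apply: leq_prod => p.
by move/mem_primes_above/andP => [/ltnW].
Qed.

Lemma idagger_correct (d : nat) (c : nat -> nat) (l : nat) : 2 <= d ->
  idagger d c l = min0 [seq i <- iota 1 (2 ^ d) | c i == l].
Proof.
move=> d_ge2; rewrite /idagger.
have mem_C i : i \in [seq i <- Cset d c l | c i == l] ->
    (1 <= i <= 2 ^ d) && (c i == l).
  by rewrite !mem_filter => /and3P[-> ->].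
have [/hasP ex_match | /hasPn none] := boolP (has (fun i => c i == l) (iota 1 (2 ^ d))).
  have ex_i : exists i, (1 <= i <= 2 ^ d) && (c i == l).
    by have [i] := ex_match; rewrite mem_iota add1n ltnS => ? ?; exists i; apply/andP.
  have [i /andP[i_in /eqP ci] i_min] := ex_minnP ex_i.
  have [p p_in good_p] := good_prime_ex d_ge2 i_in ci.
  have /andP[lt_dp pr_p] : (d < p) && prime p.
    by move: p_in; rewrite Primes_exp2E => /mem_primes_above.
  have idx_p : idx d p (Ind c l) = i.
    apply: idx_first_match => // j j_lt; apply/negP => cj.
    by have := i_min j; rewrite cj; lia.
  rewrite (@min0_eq _ i) => [||j /mem_C/i_min] //.
    rewrite (@min0_eq _ i) // => [|j].
      by rewrite mem_filter ci eqxx mem_iota add1n ltnS.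
    rewrite mem_filter mem_iota add1n ltnS => /andP[cj j_in].
    by apply: i_min; rewrite j_in.
  rewrite !mem_filter ci eqxx i_in !andTb.
  by apply/mapP; exists p.
(* Without a match, both filtered lists are empty and both minima take the default 0. *)
have -> : [seq i <- iota 1 (2 ^ d) | c i == l] = [::].
  by apply/eqP; rewrite -[_ == _]negbK -has_filter; apply/hasPn.
case E : [seq i <- Cset d c l | c i == l] => [//|i s].
have /mem_C/andP[i_in ci] : i \in [seq i <- Cset d c l | c i == l].
  by rewrite E mem_head.
by have := none i; rewrite mem_iota add1n ltnS ci i_in => /(_ isT).
Qed.

(** * Polynomial representation *)

Section PolynomialFunctions.

Local Open Scope ring_scope.

Variables (F : comNzRingType) (V : finType).

(* A monomial is the list of its variables with multiplicity, so that the
   product of monomials is concatenation and the degree is the length. *)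
Definition poly_fun (D : nat) (f : (V -> F) -> F) : Prop :=
  exists2 s : seq (F * seq V), all (fun q => size q.2 <= D)%N s &
    forall x, f x = \sum_(q <- s) q.1 * \prod_(v <- q.2) x v.

Lemma poly_fun_ext D f g : f =1 g -> poly_fun D f -> poly_fun D g.
Proof. by move=> fg [s s_le fE]; exists s => // x; rewrite -fg. Qed.

Lemma poly_fun_const D a : poly_fun D (fun=> a).
Proof. by exists [:: (a, [::])] => // x; rewrite big_seq1 big_nil mulr1. Qed.

Lemma poly_fun_var v : poly_fun 1 (fun x => x v).
Proof. by exists [:: (1, [:: v])] => // x; rewrite !big_seq1 mul1r. Qed.

Lemma poly_funD D f g : poly_fun D f -> poly_fun D g ->
  poly_fun D (fun x => f x + g x).
Proof.
move=> [s s_le fE] [s' s'_le gE]; exists (s ++ s'); first by rewrite all_cat s_le.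
by move=> x; rewrite big_cat fE gE.
Qed.

Lemma poly_funM D D' f g : poly_fun D f -> poly_fun D' g ->
  poly_fun (D + D') (fun x => f x * g x).
Proof.
move=> [s /allP s_le fE] [s' /allP s'_le gE].
exists [seq (q.1 * q'.1, q.2 ++ q'.2) | q <- s, q' <- s'].
  apply/allP => _ /allpairsP[[q q'] [/= q_in q'_in ->]] /=.
  by rewrite size_cat leq_add ?s_le ?s'_le.
move=> x; rewrite big_allpairs_dep fE gE big_distrl; apply: eq_bigr => q _.
rewrite big_distrr; apply: eq_bigr => q' _ /=; by rewrite big_cat mulrACA.
Qed.

Lemma poly_funN D f : poly_fun D f -> poly_fun D (fun x => - f x).
Proof.
move=> /(poly_funM (poly_fun_const 0 (-1))); apply: poly_fun_ext => x.
by rewrite mulN1r.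
Qed.

Lemma poly_funX D f n : poly_fun D f -> poly_fun (D * n) (fun x => f x ^+ n).
Proof.
move=> f_D; elim: n => [|n IH]; first exact: poly_fun_const.
by rewrite mulnS; apply: poly_fun_ext (poly_funM f_D IH) => x; rewrite exprS.
Qed.

Lemma poly_fun_sum (I : Type) (r : seq I) D (f : I -> (V -> F) -> F) :
  (forall i, poly_fun D (f i)) -> poly_fun D (fun x => \sum_(i <- r) f i x).
Proof.
move=> f_D; elim: r => [|i r IH].
  by apply: poly_fun_ext (poly_fun_const D 0) => x; rewrite big_nil.
by apply: poly_fun_ext (poly_funD (f_D i) IH) => x; rewrite big_cons.
Qed.

Lemma poly_fun_prod (I : Type) (r : seq I) D (f : I -> (V -> F) -> F) :
  (forall i, poly_fun D (f i)) ->
  poly_fun (D * size r) (fun x => \prod_(i <- r) f i x).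
Proof.
move=> f_D; elim: r => [|i r IH].
  by apply: poly_fun_ext (poly_fun_const _ 1) => x; rewrite big_nil.
by rewrite mulnS; apply: poly_fun_ext (poly_funM (f_D i) IH) => x; rewrite big_cons.
Qed.

Lemma sum_count_mem (w : seq V) : (\sum_v count_mem v w = size w)%N.
Proof.
elim: w => [|a w IH] /=; first by rewrite big1.
rewrite big_split /= IH (bigD1 a) //= eqxx big1 // => v /negPf.
by rewrite eq_sym => ->.
Qed.

Lemma prod_exp_count_mem (w : seq V) (x : V -> F) :
  \prod_v x v ^+ count_mem v w = \prod_(v <- w) x v.
Proof.
elim: w => [|a w IH] /=; first by rewrite big_nil big1.
under eq_bigr do rewrite exprD.
rewrite big_split /= IH big_cons (bigD1 a) //= eqxx big1 ?mulr1 // => v /negPf.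
by rewrite eq_sym => ->.
Qed.

(** A word of variables becomes the vector of its multiplicities, and the coefficients of words with
    equal vectors are added up. No multiplicity exceeds [D], so [inord] loses nothing. *)
Lemma poly_fun_mpoly D f : poly_fun D f ->
  exists a : mpoly F V D, forall x, mpoly_eval a x = f x.
Proof.
move=> [s /allP s_le fE].
pose expo (w : seq V) : {ffun V -> 'I_D.+1} := [ffun v => inord (count_mem v w)].
exists [ffun e => \sum_(q <- s) (if e == expo q.2 then q.1 else 0)] => x.
rewrite fE /mpoly_eval; under eq_bigr do rewrite ffunE big_distrl /=.
rewrite exchange_big /= big_seq [RHS]big_seq; apply: eq_bigr => q /s_le q_le.
have expoE v : expo q.2 v = count_mem v q.2 :> nat.
  by rewrite ffunE inordK // ltnS (leq_trans (count_size _ _)).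
rewrite (bigD1 (expo q.2)) /=; last first.
  by under eq_bigr do rewrite expoE; rewrite sum_count_mem.
rewrite eqxx [X in _ + X]big1 ?addr0 => [|e /andP[_ /negPf->]]; last by rewrite mul0r.
by under eq_bigr do rewrite expoE; rewrite prod_exp_count_mem.
Qed.

End PolynomialFunctions.

(** * The sketch as a polynomial in the input bits *)

Section SpiritPolynomial.

Local Open Scope ring_scope.

Variables (d t p : nat).
Hypothesis pr_p : prime p.

Local Notation V := ('I_((2 ^ d).+1) * 'I_t)%type.
Local Notation F := 'F_p.

(** On bits, each factor is 1 if they agree and 0 if not. Rows of the input count from 0: [c i] sits
    in row [i.-1] and [l] in the last row. *)
Definition match_poly (i : nat) (x : V -> F) : F :=
  \prod_(j <- enum 'I_t) (1 - (x (inord i.-1, j) - x (ord_max, j)) ^+ 2).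

(** This and the next two definitions follow the stages of [spirit]; the reductions modulo [p] are
    absorbed by ['F_p]. *)
Definition node_poly (k : nat) (x : V -> F) : F :=
  (\sum_(1 <= i < (2 ^ d).+1) (Tmat d k i)%:~R * match_poly i x) ^+ p.-1.

Definition prefix_poly (j : nat) (x : V -> F) : F :=
  (\sum_(1 <= k < 2 * 2 ^ d) (Rmat d j k)%:~R * node_poly k x) ^+ p.-1.

Definition spirit_poly (h : nat) (x : V -> F) : F :=
  \sum_(1 <= k < (2 ^ d).+1) (Smat h k)%:~R *
    (if k == 1%N then prefix_poly 1 x else prefix_poly k x - prefix_poly k.-1 x).

Lemma poly_fun_match i : poly_fun (2 * t) (match_poly i).
Proof.
rewrite -[X in (_ * X)%N](size_enum_ord t); apply: poly_fun_prod => j.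
apply: poly_funD (poly_fun_const _ _ _) (poly_funN _).
rewrite -[2%N]mul1n; apply: poly_funX.
by apply: poly_funD (poly_funN _); exact: poly_fun_var.
Qed.

Lemma poly_fun_linear (r : seq nat) D (a : nat -> F) (f : nat -> (V -> F) -> F) :
  (forall i, poly_fun D (f i)) -> poly_fun D (fun x => \sum_(i <- r) a i * f i x).
Proof.
move=> f_D; apply: poly_fun_sum => i.
exact: poly_funM (poly_fun_const _ 0 _) (f_D i).
Qed.

Lemma poly_fun_spirit h : poly_fun (2 * t * (p - 1) ^ 2) (spirit_poly h).
Proof.
have prefix_D j : poly_fun (2 * t * (p - 1) ^ 2) (prefix_poly j).
  rewrite expnS expn1 subn1 mulnA; apply: poly_funX; apply: poly_fun_linear => k.
  by apply: poly_funX; apply: poly_fun_linear => i; exact: poly_fun_match.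
apply: poly_fun_linear => k; case: eqP => _ //.
by apply: poly_funD => //; apply: poly_funN.
Qed.

Lemma intr_modz_Fp (z : int) : ((z %% p%:Z)%Z)%:~R = z%:~R :> F.
Proof.
rewrite [in RHS](divz_eq z p%:Z) [RHS]rmorphD [X in X + _]rmorphM /=.
by rewrite -[(Posz p)%:~R]/(p%:R) pchar_Fp_0 // mulr0 add0r.
Qed.

Lemma intr_ipow_modv y k : (ipow p (modv p y) k)%:~R = (y k)%:~R ^+ p.-1 :> F.
Proof. by rewrite /ipow /modv intr_modz_Fp rmorphXn /= intr_modz_Fp. Qed.

Lemma match_polyE r c l i : t = up_log 2 r ->
  (forall i, (1 <= i <= 2 ^ d)%N -> (c i < r)%N) -> (l < r)%N ->
  (1 <= i <= 2 ^ d)%N ->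
  match_poly i (@input_bits F d t c l) = (Ind c l i)%:~R.
Proof.
move=> tE c_lt l_lt i_in.
have lt_pow n : (n < r -> n < 2 ^ t)%N.
  by move=> n_lt; rewrite tE; apply: leq_trans n_lt (up_logP _ _).
have factorE (j : 'I_t) :
    1 - (@input_bits F d t c l (inord i.-1, j) - @input_bits F d t c l (ord_max, j)) ^+ 2
    = (bit (c i) j == bit l j)%:R.
  rewrite /input_bits /= ltnn inordK; last by lia.
  have -> : (i.-1 < 2 ^ d)%N by lia.
  rewrite prednK /bit; last by lia.
  by case: odd; case: odd; rewrite ?subrr ?subr0 ?sub0r ?sqrrN ?expr1n ?expr0n ?subr0 ?subrr.
rewrite /match_poly; under eq_bigr do rewrite factorE.
rewrite /Ind; case: eqP => [-> | neq].
  by rewrite big1 // => j _; rewrite eqxx.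
(* Both numbers are below [2 ^ t], so [sum_bits] would rebuild equal numbers from equal bits. *)
have [j neq_j] : exists j : 'I_t, bit (c i) j != bit l j.
  case: (pickP (fun j : 'I_t => bit (c i) j != bit l j)) => [j | same]; first by exists j.
  case: neq; rewrite -(sum_bits (lt_pow _ (c_lt _ i_in))) -(sum_bits (lt_pow _ l_lt)).
  apply: eq_big_nat => h h_in; have lt_h : (h - 1 < t)%N by lia.
  by have /negbFE/eqP/= := same (Ordinal lt_h); rewrite /bit => ->.
by rewrite (big_rem j) ?mem_enum //= (negPf neq_j) mul0r.
Qed.

Lemma spirit_polyE r c l h : t = up_log 2 r ->
  (forall i, (1 <= i <= 2 ^ d)%N -> (c i < r)%N) -> (l < r)%N ->
  spirit_poly h (@input_bits F d t c l) = (spirit d p (Ind c l) h)%:R.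
Proof.
move=> tE c_lt l_lt; set x := @input_bits _ _ _ _ _.
pose y := ipow p (modv p (Tapp d (Ind c l))).
pose u := ipow p (modv p (Rapp d y)).
have yE k : (y k)%:~R = node_poly k x.
  rewrite /y intr_ipow_modv /Tapp rmorph_sum /=; congr (_ ^+ _).
  apply: eq_big_nat => i i_in; rewrite intrM; congr (_ * _).
  by rewrite (match_polyE tE).
have uE j : (u j)%:~R = prefix_poly j x.
  rewrite /u intr_ipow_modv /Rapp rmorph_sum /=; congr (_ ^+ _).
  by apply: eq_bigr => k _; rewrite intrM yE.
rewrite /spirit -/y -/u.
(* The residue is nonnegative, so the absolute value in [spirit] leaves it unchanged. *)
have modv_ge0 : 0 <= modv p (Sapp d (Papp u)) h.
  by rewrite modz_ge0 // eqz_nat -lt0n prime_gt0.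
rewrite -[RHS]/((Posz `|_|%N)%:~R) gez0_abs // /modv intr_modz_Fp.
rewrite /Sapp rmorph_sum; apply: eq_bigr => k _ /=; rewrite intrM /Papp.
case: eqP => _; first by rewrite -uE.
by rewrite -!uE -rmorphB.
Qed.

End SpiritPolynomial.

(** * Real bounds *)

Section RealBounds.

Local Open Scope R_scope.

Lemma INR_leq (a b : nat) : (a <= b)%N -> INR a <= INR b.
Proof. by move/leP; apply: le_INR. Qed.

Lemma INR_muln (a b : nat) : INR (a * b)%N = INR a * INR b.
Proof. by rewrite -mult_INR. Qed.

Lemma INR_expn (a n : nat) : INR (a ^ n)%N = INR a ^ n.
Proof. by elim: n => // n IH; rewrite expnS INR_muln IH. Qed.

Lemma INR_ge2 (d : nat) : (2 <= d)%N -> 2 <= INR d.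
Proof. exact: (@INR_leq 2). Qed.

Lemma ln2_gt0 : 0 < ln (INR 2).
Proof. by rewrite -ln_1; apply: ln_increasing => /=; lra. Qed.

Lemma log2R_pow (x : R) (n : nat) : 0 < x -> log2R (x ^ n) = INR n * log2R x.
Proof. by move=> x_gt0; rewrite /log2R ln_pow // /Rdiv Rmult_assoc. Qed.

Lemma log2R_2 : log2R (INR 2) = 1.
Proof. by apply: Rinv_r; have := ln2_gt0; lra. Qed.

Lemma log2R_le (x y : R) : 0 < x -> x <= y -> log2R x <= log2R y.
Proof.
move=> x_gt0 xy; apply: Rmult_le_compat_r.
  by apply: Rlt_le; apply: Rinv_0_lt_compat; exact: ln2_gt0.
by case: xy => [/(ln_increasing _ _ x_gt0)/Rlt_le | ->] //; exact: Rle_refl.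
Qed.

Lemma log2R_exp2 (d : nat) : log2R (INR (2 ^ d)%N) = INR d.
Proof. by rewrite INR_expn log2R_pow ?log2R_2 /=; lra. Qed.

Lemma log2R_ge1 (d : nat) : (2 <= d)%N -> 1 <= log2R (INR d).
Proof. by move=> d_ge2; rewrite -log2R_2; apply: log2R_le => /=; [lra | exact: INR_ge2]. Qed.

Lemma leq_expn_log2R (d n k : nat) : (0 < d)%N -> (d ^ n <= 2 ^ k)%N ->
  INR n * log2R (INR d) <= INR k.
Proof.
move=> d_gt0 le_pow; have d_gt0R : 0 < INR d by apply: lt_0_INR; apply/ltP.
rewrite -log2R_pow // -INR_expn -(log2R_exp2 k); apply: log2R_le; last exact: INR_leq.
by rewrite INR_expn; apply: pow_lt.
Qed.

(** Logarithms of [d ^ n <= 2 ^ (d * d)] give [n * L <= d ^ 2]. The extra prime adds [L <= d ^ 2],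
    whence the constant 2. *)
Lemma size_Primes_bound (d : nat) : (2 <= d)%N ->
  INR (size (Primes (2 ^ d) d)) <=
  2 * (log2R (INR (2 ^ d)) ^ 2 / log2R (log2R (INR (2 ^ d)))).
Proof.
move=> d_ge2; rewrite Primes_exp2E size_primes_above log2R_exp2 S_INR.
set n := trunc_log _ _; set L := log2R _.
have L_ge1 : 1 <= L by exact: log2R_ge1.
have d_gt0 : (0 < d)%N by apply: ltnW.
have n_le : INR n * L <= INR d ^ 2.
  rewrite /= Rmult_1_r -INR_muln; apply: leq_expn_log2R => //.
  by rewrite expnM trunc_logP // !expn_gt0.
have L_le : L <= INR d.
  rewrite -[X in X <= _]Rmult_1_l -[1]/(INR 1); apply: leq_expn_log2R => //.
  by rewrite expn1 ltnW // ltn_expl.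
have d_le : INR d <= INR d ^ 2 by have := INR_ge2 d_ge2; nra.
apply: (Rmult_le_reg_r L); first lra.
have -> : 2 * (INR d ^ 2 / L) * L = 2 * INR d ^ 2 by field; lra.
nra.
Qed.

Lemma Primes_bound (d p : nat) : (2 <= d)%N -> p \in Primes (2 ^ d) d ->
  INR p <= 64 * log2R (INR (2 ^ d)) ^ 2.
Proof.
move=> d_ge2 /(Primes_exp2_leq d_ge2)/INR_leq.
by rewrite log2R_exp2 INR_muln INR_expn; have -> : INR 64 = 64 by rewrite INR_IZR_INZ.
Qed.

(** The constant is 2 * 2 * 64 ^ 2: the factor 2 of the degree, the rounding of the logarithm, and
    the square of the bound on [p - 1]. *)
Lemma degree_bound (d r p : nat) : (2 <= d)%N -> (2 <= r)%N ->
  p \in Primes (2 ^ d) d ->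
  INR (2 * up_log 2 r * (p - 1) ^ 2) <=
  16384 * (log2R (INR (2 ^ d)) ^ 4 * log2R (INR r)).
Proof.
move=> d_ge2 r_ge2 p_in; have := Primes_bound d_ge2 p_in.
rewrite log2R_exp2 => p_le.
have p1_le : INR (p - 1)%N <= 64 * INR d ^ 2.
  by apply: Rle_trans p_le; apply: INR_leq; exact: leq_subr.
have L_ge1 := log2R_ge1 r_ge2.
(* Rounding up adds at most 1, which is at most the logarithm itself since [2 <= r]. *)
have t_le : INR (up_log 2 r) <= 2 * log2R (INR r).
  have := up_log_gtn (isT : 1 < 2)%N r_ge2.
  have : (0 < up_log 2 r)%N by rewrite up_log_gt0.
  case: (up_log 2 r) => // t _ lt_r; rewrite S_INR.
  have : INR t <= log2R (INR r); last lra.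
  rewrite -(log2R_exp2 t); apply: log2R_le; last by apply: INR_leq; exact: ltnW.
  by rewrite INR_expn; apply: pow_lt => /=; lra.
rewrite (INR_muln (2 * _)) INR_expn INR_muln.
have sq_le : INR (p - 1)%N ^ 2 <= (64 * INR d ^ 2) ^ 2.
  by apply: pow_incr; split => //; exact: pos_INR.
have -> : 16384 * (INR d ^ 4 * log2R (INR r)) =
    INR 2 * (2 * log2R (INR r)) * (64 * INR d ^ 2) ^ 2 by rewrite /=; ring.
apply: Rmult_le_compat => //.
- by rewrite -INR_muln; exact: pos_INR.
- by apply: pow_le; exact: pos_INR.
- by rewrite /=; lra.
Qed.

End RealBounds.

Theorem theorem4 :
  (* correctness of the recovered index *)
  (forall (d r : nat) (c : nat -> nat) (l : nat),
     (2 <= d)%N -> (2 <= r)%N ->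
     (forall i, (1 <= i <= 2 ^ d)%N -> (c i < r)%N) -> (l < r)%N ->
     idagger d c l = min0 [seq i <- iota 1 (2 ^ d) | c i == l])
  /\
  (* |Primes_{m,d}| = O(log^2 m / log log m) *)
  (exists K : R, forall d : nat, (2 <= d)%N ->
     Rle (INR (size (Primes (2 ^ d) d)))
         (Rmult K (Rdiv (pow (log2R (INR (2 ^ d))) 2)
                        (log2R (log2R (INR (2 ^ d)))))))
  /\
  (* every prime is at most K log2^2 m *)
  (exists K : R, forall (d p : nat), (2 <= d)%N -> p \in Primes (2 ^ d) d ->
     Rle (INR p) (Rmult K (pow (log2R (INR (2 ^ d))) 2)))
  /\
  (* each coordinate of b_p is a polynomial over Z_p of degree <= 2 t (p-1)^2
     in the (m+1)t input bits *)
  (forall (d r p h : nat), (2 <= d)%N -> (2 <= r)%N ->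
     p \in Primes (2 ^ d) d -> (1 <= h <= d)%N ->
     let t := up_log 2 r in
     exists a : mpoly 'F_p ('I_((2 ^ d).+1) * 'I_t)%type (2 * t * (p - 1) ^ 2),
       forall (c : nat -> nat) (l : nat),
         (forall i, (1 <= i <= 2 ^ d)%N -> (c i < r)%N) -> (l < r)%N ->
         mpoly_eval a (@input_bits 'F_p d t c l) = ((spirit d p (Ind c l) h)%:R : 'F_p)%R)
  /\
  (* and 2 t (p-1)^2 = O(log^4 m log r) *)
  (exists K : R, forall (d r p : nat), (2 <= d)%N -> (2 <= r)%N ->
     p \in Primes (2 ^ d) d ->
     Rle (INR (2 * up_log 2 r * (p - 1) ^ 2))
         (Rmult K (Rmult (pow (log2R (INR (2 ^ d))) 4) (log2R (INR r))))).
Proof.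
split; first by move=> d r c l d_ge2 _ _ _; exact: idagger_correct.
split; first by exists (IZR 2) => d; exact: size_Primes_bound.
split; first by exists (IZR 64) => d p; exact: Primes_bound.
split; last by exists (IZR 16384) => d r p; exact: degree_bound.
move=> d r p h d_ge2 r_ge2; rewrite Primes_exp2E => /mem_primes_above/andP[_ pr_p] _ t.
have [a aE] := poly_fun_mpoly (poly_fun_spirit d t p h).
exists a => c l c_lt l_lt; rewrite aE; exact: (spirit_polyE pr_p).
Qed.
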